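(* Let $f_n \colon C^\omega \to [0,1]$, $n \in \omega$, be Baire functions. Then there exist an infinite set $N = \{ n_i \colon i \in \omega \} \subseteq \omega$ and non-empty perfect sets $P_k \subseteq C$ for $k \in \omega$ such that the subsequence $(f_{n_i})_{i \in \omega}$ is pointwise convergent on the product $\prod_{k \in \omega} P_k$.
   Context: $\omega$ denotes the set of natural numbers (including $0$). $C \subseteq \mathbb{R}$ is the standard Cantor set, identified with $2^\omega = \{0,1\}^\omega$ with the product topology; $C^\omega$ carries the product topology. A subset of a topological space is called perfect if it is compact and has no isolated points. A subset $A$ of a topological space $X$ has the Baire property if $A = U \triangle m$ (symmetric difference) for some open set $U$ and some meager set $m$. A function $f \colon X \to Y$ between topological spaces is called Baire if the preimage $f^{-1}(U)$ of every open $U \subseteq Y$ has the Baire property. An infinite set $N = \{n_i \colon i \in \omega\}\subseteq\omega$ is enumerated increasingly. *)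

(* Defs.v *)
From mathcomp Require Import all_boot all_order all_algebra.
From mathcomp Require Import all_classical all_reals all_analysis.

Set Implicit Arguments.
Unset Strict Implicit.
Unset Printing Implicit Defensive.

Import numFieldNormedType.Exports.

Local Open Scope classical_set_scope.

Definition nowhere_dense {T : topologicalType} (A : set T) : Prop :=
  interior (closure A) = set0.

Definition meager {T : topologicalType} (A : set T) : Prop :=
  exists2 F : nat -> set T,
    (forall i, nowhere_dense (F i)) & A = \bigcup_i F i.

Definition baire_property {T : topologicalType} (A : set T) : Prop :=
  exists U m : set T, [/\ open U, meager m & A = U `+` m].

Definition baire_fun {X Y : topologicalType} (f : X -> Y) : Prop :=
  forall U : set Y, open U -> baire_property (f @^-1` U).

(* Compactness is part of the definition, unlike in [perfect_set], which asks
   for a closed set.  The empty set is perfect. *)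
Definition compact_perfect {T : topologicalType} (A : set T) : Prop :=
  compact A /\ isolated A = set0.

(* C^omega, for C the Cantor set identified with 2^omega. *)
Definition cantor_omega : topologicalType :=
  prod_topology (fun _ : nat => cantor_space).

Definition unit_interval (R : realType) : topologicalType :=
  set_type (`[0%R, 1%R]%classic : set R).

Definition box (P : nat -> set cantor_space) : set cantor_omega :=
  [set x : nat -> cantor_space | forall k, P k (x k)].

(* Main.v *)
Require Import Defs.
From mathcomp Require Import all_boot all_order all_algebra.
From mathcomp Require Import all_classical all_reals all_analysis.
From mathcomp Require Import lra.
Import Order.TTheory GRing.Theory Num.Theory.
Import numFieldNormedType.Exports.
Set Implicit Arguments.
Unset Strict Implicit.
Unset Printing Implicit Defensive.
Local Open Scope classical_set_scope.

(* A fusion argument finds perfect subsets of the factors, parametrised by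
   sequences z of letters (the j-th letter offers one bit to each coordinate),
   such that on their product f_n varies by at most 1/(n+1) once the first n
   letters are fixed: the boxes of the fusion decide the open sets given by the
   Baire property of the thresholds {f_n > i/(n+1)} and avoid the exceptional
   nowhere dense sets.  So f_n is replaced by a colouring c of the words of
   length n.

   As in the Carlson-Simpson theorem, a minimal idempotent ultrafilter p on
   words is the image, under every substitution of a letter for the variable,
   of one ultrafilter q on variable words.  Let h(u) be the p-limit of c(uw) in
   w; since p is idempotent, h(u) is also the p-limit of h(uw).  Hence there are
   variable words v_0, v_1, ... such that appending v_i(a) to any
   u = v_0(a_0)...v_(i-1)(a_(i-1)), for a and the a_j in prescribed finite sets,
   moves h(u) by less than 2^-i and brings c within 2^-i of h(u), so that c
   converges along all these concatenations. *)

(** * Idempotent ultrafilters on words *)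

Definition shift {T : Type} (u : seq T) (B : set (seq T)) : set (seq T) :=
  [set w | B (u ++ w)].

(** The extension of concatenation to filters. A filter stands for the closed set of the
    ultrafilters containing it, so maximal filters of a given kind are minimal closed sets. *)
Definition conv {T : Type} (F G : set_system (seq T)) : set_system (seq T) :=
  [set B | F [set u | G (shift u B)]].

Lemma shift_cat T (u v : seq T) B : shift (u ++ v) B = shift v (shift u B).
Proof. by apply/seteqP; split=> w; rewrite /shift /= catA. Qed.

Lemma convA T (F G H : set_system (seq T)) :
  conv F (conv G H) = conv (conv F G) H.
Proof.
apply/funext => B; rewrite /conv /=; congr F.
apply/funext => u; congr G.
apply/funext => v; congr H.
by apply/funext => w; rewrite /shift /= catA.
Qed.

Lemma conv_proper T (F G : set_system (seq T)) :
  ProperFilter F -> ProperFilter G -> ProperFilter (conv F G).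
Proof.
move=> PF PG; apply: Build_ProperFilter_ex.
  by move=> B /(@filter_ex _ F)[u /(@filter_ex _ G)[w uwB]]; exists (u ++ w).
rewrite /conv; split=> /= [|A B FA FB|A B AB FA].
- by apply: filterE => u; apply: filterE.
- by apply: (filterS _ (@filterI _ F _ _ _ FA FB)) => u []; exact: filterI.
- by apply: (@filterS _ F _ _ _ _ FA) => u; apply: filterS => w; exact: AB.
Qed.

Lemma proper_ultra T (F : set_system T) :
  ProperFilter F -> (forall A, F A \/ F (~` A)) -> UltraFilter F.
Proof.
move=> PF FAC; split=> // G PG FG; apply/seteqP; split=> // A GA.
have [//|/FG GAC] := FAC A.
by have [x []] := filter_ex (filterI GA GAC).
Qed.

Lemma ultra_not T (F : set_system T) (A : set T) :
  UltraFilter F -> ~ F A -> F (~` A).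
Proof. by move=> UF; have [] := in_ultra_setVsetC A UF. Qed.

Lemma conv_ultra T (F G : set_system (seq T)) :
  UltraFilter F -> UltraFilter G -> UltraFilter (conv F G).
Proof.
move=> UF UG; apply: proper_ultra; first exact: conv_proper.
move=> B; have [|/(ultra_not UF) FNB] := pselect (conv F G B); [by left|right].
by apply: filterS FNB => u /ultra_not.
Qed.

Lemma fmap_ultra S T (g : S -> T) (F : set_system S) :
  UltraFilter F -> UltraFilter (fmap g F).
Proof.
move=> UF; apply: proper_ultra => A.
exact: in_ultra_setVsetC (g @^-1` A) UF.
Qed.

Lemma ultra_sub_eq T (F G : set_system T) :
  UltraFilter F -> ProperFilter G -> F `<=` G -> F = G.
Proof. by move=> UF PG /max_filter. Qed.

Lemma fmap_conv S T (g : seq S -> seq T) (F G : set_system (seq S)) :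
  {morph g : u v / u ++ v} -> fmap g (conv F G) = conv (fmap g F) (fmap g G).
Proof.
move=> gD; apply/funext => B; rewrite /conv /fmap /=; congr F.
apply/funext => u; congr G; apply/funext => w.
by rewrite /shift /= gD.
Qed.

Lemma maximal_filter T (Q : set_system T -> Prop) (F0 : set_system T) :
  ProperFilter F0 -> Q F0 ->
  (forall C : set (set_system T), C !=set0 ->
    (forall F, C F -> ProperFilter F /\ Q F) -> total_on C subset ->
    Q (\bigcup_(F in C) F)) ->
  exists F, [/\ ProperFilter F, Q F, F0 `<=` F &
    forall G, ProperFilter G -> Q G -> F `<=` G -> G `<=` F].
Proof.
move=> PF0 QF0 Qchain.
(* Zorn's lemma is applied to the part X added to F0, so that the empty chain, whose union is
   [set0], yields F0 itself. *)
pose P (X : set_system T) := ProperFilter (F0 `|` X) /\ Q (F0 `|` X).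
have [C CP Ctot|F [[PF QF] Fmax]] := @Zorn_bigcup _ P; last first.
  exists (F0 `|` F); split=> // G PG QG FG A GA; apply: contrapT => nFA.
  have F0G : F0 `|` G = G by apply/setUidPr => B ?; apply: FG; left.
  apply: (Fmax G); last by rewrite /P F0G.
  split=> [B FB|/(_ _ GA) FA]; first by apply: FG; right.
  by apply: nFA; right.
have [->|/set0P C0] := eqVneq C set0; first by rewrite /P bigcup_set0 setU0.
pose C' := [set F0 `|` X | X in C].
have C'0 : C' !=set0 by case: C0 => X CX; exists (F0 `|` X), X.
have C'E : F0 `|` \bigcup_(X in C) X = \bigcup_(X in C') X.
  apply/seteqP; split=> [A [F0A|[X CX XA]]|A [_ [X CX <-] [F0A|XA]]].
  - by case: C0 => X CX; exists (F0 `|` X); [exists X|left].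
  - by exists (F0 `|` X); [exists X|right].
  - by left.
  - by right; exists X.
have C'tot : total_on C' subset.
  move=> _ _ [X CX <-] [Y CY <-].
  by have [XY|YX] := Ctot _ _ CX CY; [left|right]; apply: setUS.
have C'P X : C' X -> ProperFilter X /\ Q X by move=> [Y /CP ? <-].
rewrite /P C'E; split; last exact: Qchain.
apply: Build_ProperFilter_ex.
  by move=> A [X /C'P[PX _]]; exact: filter_ex.
split.
- have [X C'X] := C'0; exists X => //; have [PX _] := C'P _ C'X.
  exact: filterT.
- move=> A B [X CX XA] [Y CY YB]; have [[PX _] [PY _]] := (C'P _ CX, C'P _ CY).
  have [XY|YX] := C'tot _ _ CX CY; [exists Y|exists X] => //.
    by apply: filterI => //; exact: XY.
  by apply: filterI => //; exact: YX.
- move=> A B AB [X CX XA]; exists X => //.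
  by have [PX _] := C'P _ CX; exact: filterS XA.
Qed.

Lemma conv_mono T (F F' G G' : set_system (seq T)) :
  Filter F -> F `<=` F' -> G `<=` G' -> conv F G `<=` conv F' G'.
Proof. by move=> FF FF' GG' B FGB; apply/FF'/filterS/FGB => u; exact: GG'. Qed.

(* This filter generates the closed set of the ultrafilters s containing G such
   that conv s p = r. *)
Lemma left_solutions_proper T (G p r : set_system (seq T)) :
  ProperFilter G -> UltraFilter p -> UltraFilter r -> conv G p `<=` r ->
  ProperFilter [set D | exists X B, [/\ G X, r B &
    X `&` [set u | p (shift u B)] `<=` D]].
Proof.
move=> PG Up Ur Gpr; apply: Build_ProperFilter_ex.
  move=> D [X [B [GX rB XBD]]]; apply: contrapT => D0.
  have : conv G p (~` B).
    rewrite /conv /=; apply: filterS GX => u Xu; apply: ultra_not => puB.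
    by apply: D0; exists u; apply: XBD.
  by move=> /Gpr rNB; have [? []] := filter_ex (filterI rB rNB).
split.
- by exists setT, setT; split=> //; exact: filterT.
- move=> D D' [X [B [GX rB XBD]]] [X' [B' [GX' rB' XBD']]].
  exists (X `&` X'), (B `&` B'); split; [exact: filterI..|].
  move=> u [[Xu Xu'] puB]; split; [apply: XBD|apply: XBD']; split=> //=.
    by apply: filterS puB => w [].
  by apply: filterS puB => w [].
- move=> D D' DD' [X [B [GX rB XBD]]]; exists X, B; split=> //.
  exact: subset_trans XBD DD'.
Qed.

(** The Ellis-Numakura argument: the hypothesis makes the closed set of F a subsemigroup. Let p lie
    in a minimal closed subsemigroup K, with filter G. Then K p = K by minimality, so the s in K
    with s p = p form a nonempty closed subsemigroup, which is all of K and contains p. *)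
Lemma ellis T (F : set_system (seq T)) : ProperFilter F -> F `<=` conv F F ->
  exists p, [/\ UltraFilter p, F `<=` p & conv p p = p].
Proof.
move=> PF FFF.
have [C _ CQ Ctot|G [PG GGG FG Gmax]] :=
    @maximal_filter _ (fun F => F `<=` conv F F) F PF FFF.
  move=> A [X CX XA]; exists X => //; have [PX XXX] := CQ _ CX.
  have XXA : X [set u | X (shift u A)] := XXX _ XA.
  by apply: filterS XXA => u XuA; exists X.
have [p [Up Gp]] := ultraFilterLemma PG.
have GpG : conv G p `<=` G.
  apply: Gmax; first exact: conv_proper.
    apply: (@subset_trans _ (conv (conv G G) p)).
      exact: conv_mono.
    rewrite [X in _ `<=` X]convA; apply: conv_mono => //.
      exact: conv_proper.
    apply: (@subset_trans _ (conv G (conv G G))); first exact: conv_mono.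
    rewrite -convA; apply: conv_mono => //.
    exact: conv_mono.
  apply: (subset_trans GGG); exact: conv_mono.
have Gpp : conv G p `<=` p by exact: subset_trans GpG Gp.
have PH := left_solutions_proper PG Up Up Gpp.
set H := (X in ProperFilter X) in PH.
have HG : H `<=` G.
  apply: Gmax => //.
    move=> D [X [B [GX pB XBD]]]; rewrite /conv /=.
    exists [set u | G (shift u X)], B; split=> //; first exact: GGG.
    move=> u [/= GuX puB]; exists (shift u X), (shift u B); split=> //.
    move=> w [Xuw puwB]; apply: XBD; split=> //=.
    by rewrite shift_cat.
  move=> X GX; exists X, setT.
  by split; [by []|exact: filterT|move=> ? []].
exists p; split=> //; first exact: subset_trans FG Gp.
apply/esym/ultra_sub_eq => [|B pB]; first exact: conv_proper.
apply/Gp/HG; exists setT, B.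
by split; [exact: filterT| |move=> u []].
Qed.

(** [None] is the variable. Both kinds of words live in one semigroup, so that ultrafilters on
    either kind can be multiplied. *)
Definition constant_word {A : Type} : set (seq (option A)) :=
  [set w | all isSome w].

Definition variable_word {A : Type} : set (seq (option A)) :=
  [set w | ~~ all isSome w].

Definition subst {A : Type} (a : A) : seq (option A) -> seq A := map (odflt a).

(** F describes a minimal closed left ideal over the semigroup W, containing p and r. The left ideal
    generated by r is then the whole ideal, so p = s r for some s and p r = s r r = p, while p r = r
    by hypothesis. The proof argues with the filter G of the ideal generated by r instead of s. *)
Lemma minimal_idempotent_eq (T : Type) (W : set (seq T))
    (p r F : set_system (seq T)) :
  UltraFilter p -> UltraFilter r -> p W -> conv r r = r -> r `<=` conv p r ->
  F `<=` p ->
  (forall G, ProperFilter G -> G W ->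
    (forall B u, G B -> W u -> G (shift u B)) -> F `<=` G -> G `<=` F) ->
  F `<=` r ->
  (forall u, W u -> r (shift u W)) ->
  (forall u v, W u -> W v -> W (u ++ v)) ->
  (forall B u, F B -> W u -> F (shift u B)) ->
  p = r.
Proof.
move=> Up Ur pW rr rpr Fp Fmax Fr rW WW FT.
pose G := [set B | forall u, W u -> r (shift u B)].
have PG : ProperFilter G.
  apply: Build_ProperFilter_ex.
    move=> B GB; have [u Wu] := filter_ex pW.
    by have [w uwB] := filter_ex (GB _ Wu); exists (u ++ w).
  split=> /= [u _|A B GA GB u Wu|A B AB GA u Wu].
  - exact: filterT.
  - exact: filterI (GA _ Wu) (GB _ Wu).
  - by apply: filterS (GA _ Wu) => w; exact: AB.
have GF : G `<=` F.
  apply: Fmax => // [B u GB Wu v Wv|B FB u Wu]; last exact/Fr/FT.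
  by rewrite -shift_cat; exact/GB/WW.
apply/esym/ultra_sub_eq => B rB; apply: contrapT => /ultra_not pNB.
have pB' : p [set u | r (shift u B)] := rpr _ rB.
pose E := ~` B `&` [set u | r (shift u B)].
have pE : p E by exact: filterI.
have : ~ G (~` E).
  by move=> /GF/Fp pNE; have [? []] := filter_ex (filterI pE pNE).
apply => u Wu; apply: ultra_not => ruE.
have ruNB : r (shift u (~` B)) by apply: filterS ruE => w [].
have ruB : r (shift u B).
  rewrite -rr /conv /=.
  by apply: filterS ruE => w [_]; rewrite /= shift_cat.
by have [? []] := filter_ex (filterI ruB ruNB).
Qed.

(** Let p be an idempotent of a minimal left ideal on constant words and e an idempotent on variable
    words with e p = e. Then q = p e is an idempotent with p q = q p = q. Substituting a letter is a
    morphism fixing p, so it maps q to an idempotent below p, which minimality forces to be p. *)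
Lemma variable_ultrafilter (A : Type) :
  exists p q : set_system (seq (option A)),
    [/\ UltraFilter p, UltraFilter q, conv p p = p, q variable_word &
      [/\ p constant_word & forall a : A, fmap (map Some \o subst a) q = p]].
Proof.
pose W := @constant_word A; pose V := @variable_word A.
have WW u v : W u -> W v -> W (u ++ v).
  by rewrite /W /constant_word /= all_cat => -> ->.
have Vl u v : V u -> V (u ++ v).
  by rewrite /V /variable_word /= all_cat => /negbTE ->.
pose Q (F : set_system (seq (option A))) :=
  forall B u, F B -> W u -> F (shift u B).
have [|||F [PF QF WF Fmax]] := @maximal_filter _ Q [set B | W `<=` B].
- apply: Build_ProperFilter_ex; first by move=> B WB; exists [::]; apply: WB.
- by move=> B u /= WB Wu w Ww; apply: WB; exact: WW.
- move=> C _ CQ _ B u [X CX XB] Wu; exists X => //.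
  by have [_] := CQ _ CX; apply.
have FW : F W by exact: WF.
have [p [Up Fp pp]] : exists p, [/\ UltraFilter p, F `<=` p & conv p p = p].
  apply: ellis => B FB; rewrite /conv /=; apply: filterS FW => u Wu.
  exact: QF.
have pW := Fp _ FW.
(* This filter describes the closure of the products v p, a subsemigroup because v w is a variable
   word as soon as v is. Its members s satisfy s p = s since p is idempotent. *)
pose G := [set B | forall v, V v -> p (shift v B)].
have PG : ProperFilter G.
  apply: Build_ProperFilter_ex.
    move=> B GB; have V0 : V [:: None] by [].
    by have [w wB] := filter_ex (GB _ V0); exists ([:: None] ++ w).
  split=> /= [u _|B C GB GC u Wu|B C BC GB u Wu].
  - exact: filterT.
  - exact: filterI (GB _ Wu) (GC _ Wu).
  - by apply: filterS (GB _ Wu) => w; exact: BC.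
have GV : G V by move=> v Vv; apply: filterE => w; exact: Vl.
have [e [Ue Ge ee]] : exists e, [/\ UltraFilter e, G `<=` e & conv e e = e].
  apply: ellis => // B GB; rewrite /conv /=.
  apply: (@filterS _ G _ _ _ _ GV) => u Vu v Vv.
  by rewrite -shift_cat; apply/GB/Vl.
have ep : conv e p = e.
  apply/esym/ultra_sub_eq => [|B eB]; first exact: conv_proper.
  rewrite /conv /=; suff eE : e [set u | B u -> p (shift u B)].
    by apply: filterS (filterI eB eE) => u [Bu]; apply.
  apply: Ge => v Vv.
  have [pvB|/ultra_not pvNB] := pselect (p (shift v B)).
    have ppvB : p [set w | p (shift w (shift v B))] by rewrite -pp in pvB.
    apply: filterS ppvB => w; rewrite /shift /=.
    by under eq_set do rewrite catA.
  by apply: filterS pvNB => w nB /nB.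
pose q := conv p e.
have Uq : UltraFilter q by exact: conv_ultra.
have qq : conv q q = q by rewrite /q -convA (convA e) ep ee.
have pq : conv p q = q by rewrite /q convA pp.
have qp : conv q p = q by rewrite /q -convA ep.
exists p, q; split=> //.
  rewrite /q /conv /=; apply: filterE => u; apply: filterS (Ge _ GV) => v.
  by rewrite /V /variable_word /shift /= all_cat negb_and orbC => ->.
split=> // a.
pose g : seq (option A) -> seq (option A) := map Some \o subst a.
have gD : {morph g : u v / u ++ v}.
  by move=> u v; rewrite /g /subst /= !map_cat.
have gW w : W (g w) by rewrite /W /constant_word /g /= all_map; elim: w.
have gid w : W w -> g w = w.
  by rewrite /W /constant_word /g /=; elim: w => //= -[b|] w //= IH /IH ->.
have gp : fmap g p = p.
  apply/esym/ultra_sub_eq => B pB.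
  suff : p (g @^-1` B) by [].
  by apply: filterS (filterI pB pW) => w [Bw /gid gw]; rewrite /preimage /= gw.
have Ur : UltraFilter (fmap g q) by exact: fmap_ultra.
have rr : conv (fmap g q) (fmap g q) = fmap g q by rewrite -fmap_conv // qq.
have pr : conv p (fmap g q) = fmap g q by rewrite -{1}gp -fmap_conv // pq.
have rp : conv (fmap g q) p = fmap g q by rewrite -{1}gp -fmap_conv // qp.
apply/esym/(minimal_idempotent_eq (W := W) (F := F)) => //.
- by rewrite pr.
- by move=> H PH HW HQ FH; apply: Fmax => //; move=> B u; exact: HQ.
- move=> B FB; rewrite -rp; suff : q [set u | p (shift (g u) B)] by [].
  by apply: filterE => w; apply: Fp; exact: QF.
- move=> u Wu; suff : q [set w | W (u ++ g w)] by [].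
  by apply: filterE => w; exact: WW.
Qed.

(** Deleting the variables is a morphism that inverts [map Some], so it transports p to words over
    A. *)
Lemma substitution_ultrafilters (A : Type) :
  exists (p : set_system (seq A)) (q : set_system (seq (option A))),
    [/\ UltraFilter p, UltraFilter q, conv p p = p, q variable_word &
      forall a : A, fmap (subst a) q = p].
Proof.
have [p [q [Up Uq pp qV [_ qp]]]] := variable_ultrafilter A.
pose g : seq (option A) -> seq A := pmap id.
exists (fmap g p), q; split=> //; first exact: fmap_ultra.
  by rewrite -fmap_conv ?pp // => u v; rewrite /g pmap_cat.
move=> a; rewrite -(qp a).
have gE : g \o (map Some \o subst a) = subst a.
  by apply/funext => w /=; elim: (subst a w) => //= b {}w ->.
by rewrite -[in LHS]gE.
Qed.

Fixpoint blocks {A : Type} (v : nat -> seq (option A)) (a : nat -> A) n :=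
  if n is m.+1 then blocks v a m ++ subst (a m) (v m) else [::].

Lemma filter_all_seq T (I : eqType) (p : set_system T) (s : seq I)
    (B : I -> set T) :
  Filter p -> (forall i, i \in s -> p (B i)) ->
  p [set w | forall i, i \in s -> B i w].
Proof.
move=> Fp; elim: s => [_|i s IHs psB]; first exact: filterE.
have pB := psB i (mem_head _ _).
have /IHs pA j : j \in s -> p (B j).
  by move=> js; apply: psB; rewrite inE js orbT.
apply: filterS (filterI pB pA) => w [Bw Aw] j.
by rewrite inE => /orP[/eqP->|/Aw].
Qed.

(** * Fusion on cylinders *)

Definition cyl (n : nat) (x : nat -> nat -> bool) : set (nat -> nat -> bool) :=
  [set y | forall k i, k < n -> i < n -> y k i = x k i].

Definition cyl_open (O : set (nat -> nat -> bool)) : Prop :=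
  forall x, O x -> exists n, cyl n x `<=` O.

Lemma cyl_trans m n x y : m <= n -> cyl m x y -> cyl n y `<=` cyl m x.
Proof.
move=> mn xy z yz k i km im; rewrite yz ?xy //; exact: leq_trans mn.
Qed.

Definition decides (D O : set (nat -> nat -> bool)) : Prop :=
  D `<=` O \/ D `&` O = set0.

Lemma decidesS D D' O : D' `<=` D -> decides D O -> decides D' O.
Proof.
move=> D'D [DO|DO]; [left; exact: subset_trans DO|right].
by apply/seteqP; split=> // x [/D'D Dx Ox]; rewrite -DO.
Qed.

(* t k b is the point chosen on coordinate k when the bits b are offered to that
   coordinate; z j k is the bit offered by the j-th letter to coordinate k. *)
Definition apply_tree (t : nat -> (nat -> bool) -> nat -> bool)
    (z : nat -> nat -> bool) : nat -> nat -> bool :=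
  fun k => t k (z ^~ k).

(* The bits offered to coordinate k before stage k are ignored, so that only
   finitely many boxes have to be treated at each stage. *)
Definition local_at (n : nat)
    (t : nat -> (nat -> bool) -> nat -> bool) : Prop :=
  forall k b b', (forall j, k <= j < n -> b j = b' j) -> t k b = t k b'.

(** At a fusion stage (t, d) only the values at k, i < d are final. *)
Definition extends (t t' : nat -> (nat -> bool) -> nat -> bool) (d d' : nat) :=
  d <= d' /\ forall k b i, k < d -> i < d -> t' k b i = t k b i.

Lemma extends_refl t d : extends t t d d. Proof. by split. Qed.

Lemma extends_trans t1 t2 t3 d1 d2 d3 :
  extends t1 t2 d1 d2 -> extends t2 t3 d2 d3 -> extends t1 t3 d1 d3.
Proof.
move=> [d12 t12] [d23 t23]; split=> [|k b i kd id]; first exact: leq_trans d23.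
by rewrite t23 ?t12 //; exact: leq_trans d12.
Qed.

Lemma extends_cyl t t' d d' z : extends t t' d d' ->
  cyl d' (apply_tree t' z) `<=` cyl d (apply_tree t z).
Proof.
by move=> [dd' tt']; apply: cyl_trans => // k i kd id; rewrite /apply_tree tt'.
Qed.

Lemma extend_decide_one n t d O z : cyl_open O -> local_at n t ->
  exists t' d', [/\ local_at n t', extends t t' d d' &
    decides (cyl d' (apply_tree t' z)) O].
Proof.
move=> oO tn.
have [DO|/set0P[y [yt Oy]]] := eqVneq (cyl d (apply_tree t z) `&` O) set0.
  by exists t, d; split=> //; right.
have [e eO] := oO _ Oy.
(* The parameters that t cannot tell from z on coordinate k are all sent to y k. As y lies in the
   old cylinder, the first d values do not change. *)
pose near_z k b := `[< forall j, k <= j < n -> b j = z j k >].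
pose t' k b := if near_z k b then y k else t k b.
have t'z : apply_tree t' z = y.
  by apply/funext => k; rewrite /apply_tree /t' ifT //; apply/asboolP.
exists t', (maxn d e); split.
- move=> k b b' bb'; rewrite /t'; have -> : near_z k b = near_z k b'.
    by apply/asboolP/asboolP => H j kj; rewrite -H // bb'.
  by case: ifP => // _; exact: tn.
- split=> [|k b i kd id]; first exact: leq_maxl.
  rewrite /t'; case: ifPn => // /asboolP bz.
  by rewrite yt // /apply_tree (tn _ _ _ bz).
- left; rewrite t'z; apply: subset_trans eO; apply: cyl_trans => //.
  exact: leq_maxr.
Qed.

Lemma extend_decide_seq n t d
    (s : seq ((nat -> nat -> bool) * set (nat -> nat -> bool))) :
  (forall x, x \in s -> cyl_open x.2) -> local_at n t ->
  exists t' d', [/\ local_at n t', extends t t' d d' &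
    forall x, x \in s -> decides (cyl d' (apply_tree t' x.1)) x.2].
Proof.
elim: s t d => [|x s IHs] t d os tn; first by exists t, d; split.
have [t1 [d1 [t1n e1 D1]]] := extend_decide_one d x.1 (os _ (mem_head _ _)) tn.
have [|t2 [d2 [t2n e2 D2]]] := IHs t1 d1 _ t1n.
  by move=> y ys; apply: os; rewrite inE ys orbT.
exists t2, d2; split=> //; first exact: extends_trans e2.
move=> y; rewrite inE => /orP[/eqP->|/D2 //].
exact: (decidesS (@extends_cyl _ _ _ _ _ e2) D1).
Qed.

(** Padding with [false] turns a finite word into one sequence beginning with it, a representative
    of its cylinder. *)
Definition word_bits (w : seq (seq bool)) (j k : nat) : bool :=
  nth false (nth [::] w j) k.

Lemma finite_prefixes n : exists s : seq (nat -> nat -> bool),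
  forall z : nat -> nat -> bool,
    exists2 z', z' \in s & forall j k, j < n -> k < n -> z j k = z' j k.
Proof.
exists [seq word_bits (map val (val w)) |
  w <- enum {: n.-tuple (n.-tuple bool)}].
move=> z; pose w := [tuple [tuple z j k | k < n] | j < n].
exists (word_bits (map val (val w))); first by apply: map_f; rewrite mem_enum.
move=> j k jn kn; rewrite /word_bits /=.
rewrite -map_comp (nth_map (Ordinal jn)) ?size_enum_ord //=.
by rewrite (nth_map (Ordinal kn)) ?size_enum_ord //= !nth_enum_ord.
Qed.

(** One stage of the fusion: the sets of L are decided on the finitely many boxes of stage n, then a
    fresh position records the n-th bit. *)
Lemma extend_split n t d (L : seq (set (nat -> nat -> bool))) :
  (forall O, O \in L -> cyl_open O) -> local_at n t -> n <= d ->
  exists t' d', [/\ local_at n.+1 t', n.+1 <= d', extends t t' d d',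
    forall z O, O \in L -> exists e u,
      decides (cyl e u) O /\ forall z', (forall j k, j < n -> z j k = z' j k) ->
        cyl d' (apply_tree t' z') `<=` cyl e u &
    forall k b b', k <= n -> b n != b' n ->
      exists2 i, i < d' & t' k b i != t' k b' i].
Proof.
move=> oL tn nd.
have [Z ZP] := finite_prefixes n.
have oZ x : x \in [seq (z, U) | z <- Z, U <- L] -> cyl_open x.2.
  by move=> /allpairsP[[z O] [/= _ OL ->]] /=; exact: oL.
have [t1 [d1 [t1n e1 D1]]] := extend_decide_seq d oZ tn.
(* Position d1 is not yet final. It is left blank for k > n, since such coordinates must ignore the
   n-th bit. *)
pose t' k b i := if i == d1 then b n && (k <= n) else t1 k b i.
have e' : extends t1 t' d1 d1.+1.
  by split=> // k b i kd id; rewrite /t' ltn_eqF.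
have dd1 : d <= d1 by case: e1.
exists t', d1.+1; split.
- move=> k b b' bb'; apply/funext => i; rewrite /t'; case: ifP => // _.
    by have [kn|] := leqP k n; rewrite ?andbF // bb' // kn /=.
  have -> // : t1 k b = t1 k b'.
  by apply: t1n => j /andP[kj jn]; apply: bb'; rewrite kj ltnW.
- by rewrite ltnS (leq_trans nd).
- exact: extends_trans e'.
- move=> z O OL; have [z1 z1Z zz1] := ZP z.
  exists d1, (apply_tree t1 z1); split.
    by apply: (D1 (z1, O)); apply/allpairsP; exists (z1, O).
  move=> z' zz'.
  (* Coordinate k reads only the bits at k <= j < n, so agreement of z1 with z for j, k < n
     suffices. *)
  have -> : apply_tree t1 z1 = apply_tree t1 z'.
    apply/funext => k; apply: t1n => j /andP[kj jn].
    by rewrite -zz1 ?zz' //; exact: leq_ltn_trans jn.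
  exact: extends_cyl.
- move=> k b b' kn bb'; exists d1 => //.
  by rewrite /t' eqxx kn !andbT.
Qed.

Lemma fusion (L : nat -> seq (set (nat -> nat -> bool))) :
  (forall n O, O \in L n -> cyl_open O) ->
  exists E : nat -> (nat -> bool) -> nat -> bool,
    [/\ forall k i, exists n, forall b b', (forall j, j < n -> b j = b' j) ->
          E k b i = E k b' i,
        forall k n b b', k <= n -> b n != b' n -> E k b <> E k b' &
        forall n z O, O \in L n -> exists e u,
          decides (cyl e u) O /\
          forall z', (forall j k, j < n -> z j k = z' j k) ->
            cyl e u (apply_tree E z')].
Proof.
move=> oL.
pose state := ((nat -> (nat -> bool) -> nat -> bool) * nat)%type.
have /choice[step stepP] : forall x : nat * state, exists x' : state,
    local_at x.1 x.2.1 -> x.1 <= x.2.2 ->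
    [/\ local_at x.1.+1 x'.1, x.1.+1 <= x'.2, extends x.2.1 x'.1 x.2.2 x'.2,
    forall z O, O \in L x.1 -> exists e u,
      decides (cyl e u) O /\
      forall z', (forall j k, j < x.1 -> z j k = z' j k) ->
        cyl x'.2 (apply_tree x'.1 z') `<=` cyl e u &
    forall k b b', k <= x.1 -> b x.1 != b' x.1 ->
      exists2 i, i < x'.2 & x'.1 k b i != x'.1 k b' i].
  move=> [n [t d]] /=.
  (* States violating the invariant get an arbitrary successor; they are never reached. *)
  have [[tn nd]|H] := pselect (local_at n t /\ n <= d); last first.
    by exists (t, d) => tn nd; case: H.
  by have [t' [d' H]] := extend_split (oL n) tn nd; exists (t', d').
pose fix st n : state :=
  if n is m.+1 then step (m, st m) else ((fun _ _ _ => false), 0).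
have stI n : local_at n (st n).1 /\ n <= (st n).2.
  elim: n => [|n [tn nd]]; first by split.
  by have [] := stepP (n, st n) tn nd.
have stS n := stepP (n, st n) (stI n).1 (stI n).2.
have ext m n : m <= n -> extends (st m).1 (st n).1 (st m).2 (st n).2.
  move=> /subnK <-; elim: (n - m) => [|k IHk]; first exact: extends_refl.
  by apply: (extends_trans IHk); have [] := stS (k + m).
(* The precision of a stage is at least its index, so the value at (k, i) is already final at this
   stage. *)
pose E k b i := (st (maxn k i).+1).1 k b i.
have EE n k b i : k < (st n).2 -> i < (st n).2 -> E k b i = (st n).1 k b i.
  move=> kn im; have [_ le] := stI (maxn k i).+1.
  have km : k < (st (maxn k i).+1).2.
    by apply: leq_trans le; rewrite ltnS leq_maxl.
  have im' : i < (st (maxn k i).+1).2.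
    by apply: leq_trans le; rewrite ltnS leq_maxr.
  have [/ext[_ e]|/ltnW/ext[_ e]] := leqP n (maxn k i).+1.
    by rewrite /E e.
  by rewrite /E e.
exists E; split.
- move=> k i; exists (maxn k i).+1 => b b' bb'; rewrite /E.
  have [tn _] := stI (maxn k i).+1.
  by rewrite (tn k b b') // => j /andP[_]; exact: bb'.
- move=> k n b b' kn bb'; have [_ nd _ _ sp] := stS n.
  have [i id tb Eb] := sp k b b' kn bb'.
  move: tb; rewrite -!(EE n.+1) ?Eb ?eqxx //; exact: leq_ltn_trans nd.
- move=> n z O OL; have [_ nd _ D _] := stS n.
  have [e [u [Du uz]]] := D z O OL; exists e, u; split=> // z' zz'.
  by apply: (uz z' zz') => k i kd id; rewrite /apply_tree (EE n.+1).
Qed.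

(** * The product topology *)

(** Asking for all m >= n lets one index bound both the coordinates and the precision in a
    product. *)
Definition nbhs_basis {T : topologicalType} (N : nat -> T -> set T) : Prop :=
  (forall n x, nbhs x (N n x)) /\
  forall x U, nbhs x U -> exists n, forall m, n <= m -> N m x `<=` U.

Lemma prod_nbhs_basis (K : topologicalType) (N : nat -> K -> set K) :
  (forall m n x, m <= n -> N n x `<=` N m x) -> nbhs_basis N ->
  nbhs_basis (fun n (x : prod_topology (fun _ : nat => K)) =>
    [set y | forall k, k < n -> N n (x k) (y k)]).
Proof.
move=> Nmono [Nnbhs Nbasis].
have mono m n (x : prod_topology (fun _ : nat => K)) : m <= n ->
    [set y | forall k, k < n -> N n (x k) (y k)] `<=`
    [set y | forall k, k < m -> N m (x k) (y k)].
  by move=> mn y yx k km; apply: (Nmono _ n) => //; apply/yx/(leq_trans km).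
split=> [n x|x U xU].
  have : forall k, k \in iota 0 n -> nbhs x (proj k @^-1` N n (x k)).
    by move=> k _; exact: (@proj_continuous _ (fun _ => K)).
  move=> /filter_all_seq; apply: filterS => y yN k kn.
  by apply: yN; rewrite mem_iota.
(* The product topology is a supremum of initial topologies, so convergence of this filter to x can
   be checked on each coordinate. *)
pose F : set_system (prod_topology (fun _ : nat => K)) :=
  filter_from setT (fun n => [set y | forall k, k < n -> N n (x k) (y k)]).
have FF : Filter F.
  apply: filter_from_filter; first by exists 0.
  move=> i j _ _; exists (maxn i j) => // y yN.
  by split; apply: mono yN; rewrite ?leq_maxl ?leq_maxr.
have /(_ U xU)[n _ nU] : F --> x.
  apply/cvg_sup => k V.
  have /= -> := @nbhsE (initial_topology (fun f : nat -> K => f k)) x.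
  case=> B [[C oC <- Cx]] /filterS; apply.
  have [n nC] := Nbasis (x k) C (open_nbhs_nbhs (conj oC Cx)).
  exists (maxn n k.+1) => // y yN.
  apply: (nC (maxn n k.+1)); first exact: leq_maxl.
  by apply: yN; exact: leq_maxr.
by exists n => m nm; apply: subset_trans nU; exact: mono.
Qed.

Lemma bool_nbhs_basis : nbhs_basis (fun (_ : nat) (b : bool) => [set b]).
Proof.
split=> [_ b|b U bU].
  by apply: open_nbhs_nbhs; split=> //; exact: discrete_open.
by exists 0 => _ _ _ ->; exact: nbhs_singleton.
Qed.

Lemma cantor_nbhs_basis : nbhs_basis (fun n (x : cantor_space) =>
  [set y : cantor_space | forall i, i < n -> y i = x i]).
Proof. by apply: (prod_nbhs_basis _ bool_nbhs_basis) => m n b _ y. Qed.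

Lemma cantor_omega_nbhs_basis :
  nbhs_basis (fun n (x : cantor_omega) => cyl n x : set cantor_omega).
Proof.
have [N1 N2] : nbhs_basis (fun n (x : cantor_omega) =>
    [set y : cantor_omega |
      forall k, k < n -> forall i, i < n -> y k i = x k i]).
  apply: (prod_nbhs_basis _ cantor_nbhs_basis) => m n x mn y yx i im.
  exact/yx/(leq_trans im).
split=> [n x|x U xU].
  by apply: filterS (N1 n x) => y yx k i kn; exact: yx.
have [n nU] := N2 x U xU; exists n => m nm y yx.
by apply: (nU m nm) => k km i; exact: yx.
Qed.

Lemma open_cyl_open (U : set cantor_omega) : open U -> cyl_open U.
Proof.
rewrite openE => oU x /oU xU.
by have [n nU] := cantor_omega_nbhs_basis.2 _ _ xU; exists n; exact: nU.
Qed.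

Lemma cyl_meets_dense (F : set cantor_omega) n (x : cantor_omega) :
  nowhere_dense F -> exists2 y, cyl n x y & ~ closure F y.
Proof.
move=> F0; apply: contrapT => H.
suff : (closure F)^° x by rewrite F0.
apply: filterS (cantor_omega_nbhs_basis.1 n x) => y xy.
by apply: contrapT => nFy; apply: H; exists y.
Qed.

(** Finite dependence of each value gives continuity, hence compactness of the range. Arbitrarily
    near each b another value is taken, so no point is isolated. *)
Lemma compact_perfect_range (g : (nat -> bool) -> nat -> bool) :
  (forall i, exists n, forall b b', (forall j, j < n -> b j = b' j) ->
    g b i = g b' i) ->
  (forall b n, exists2 b', (forall j, j < n -> b j = b' j) & g b' <> g b) ->
  compact_perfect (range (g : cantor_space -> cantor_space)) /\
  range (g : cantor_space -> cantor_space) !=set0.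
Proof.
move=> gcont gflip.
have gunif m : exists n, forall b b', (forall j, j < n -> b j = b' j) ->
    forall i, i < m -> g b i = g b' i.
  elim: m => [|m [n IH]]; first by exists 0.
  have [n' gm] := gcont m; exists (maxn n n') => b b' bb' i.
  rewrite ltnS leq_eqVlt => /orP[/eqP->|im].
    by apply: gm => j jn; apply: bb'; rewrite leq_max jn orbT.
  by apply: IH im => j jn; apply: bb'; rewrite leq_max jn.
split; last by exists (g (fun _ => false)), (fun _ => false).
split.
  apply: continuous_compact; last exact: cantor_space_compact.
  apply: continuous_subspaceT => b U.
  move=> /cantor_nbhs_basis.2[m mU].
  have [n gn] := gunif m.
  apply: filterS (cantor_nbhs_basis.1 n b) => b' bb'.
  by apply: (mU m) => // i im; apply: gn im => j jn; exact: bb'.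
apply/seteqP; split=> // x [/set_mem[b _ <-] [V bV Vx]].
have [m mV] := cantor_nbhs_basis.2 _ _ bV.
have [n gn] := gunif m; have [b' bb' nb'] := gflip b n.
apply: nb'; suff : [set g b] (g b') by [].
rewrite -Vx; split; last by exists b'.
by apply: (mV m) => // i im; apply: gn im => j jn; rewrite bb'.
Qed.

Lemma cvg_set_type (T : topologicalType) (A : set T)
    (F : set_system (set_type A)) (l : set_type A) : Filter F ->
  set_val @ F --> (set_val l : T) -> F --> l.
Proof.
move=> FF Fl U; have /= -> := @nbhsE (initial_topology (@set_val T A)) l.
case=> B [[C oC <- Cl]] /filterS; apply.
exact: (Fl C (open_nbhs_nbhs (conj oC Cl))).
Qed.

(** * Concatenations of substituted words *)

Lemma size_blocks A (v : nat -> seq (option A)) a n :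
  size (blocks v a n) = \sum_(j < n) size (v j).
Proof.
elim: n => [|n IHn] /=; first by rewrite big_ord0.
by rewrite size_cat size_map big_ord_recr IHn.
Qed.

Lemma word_bits_cat u w j k : word_bits (u ++ w) j k =
  if j < size u then word_bits u j k else word_bits w (j - size u) k.
Proof. by rewrite /word_bits nth_cat; case: ifP. Qed.

Lemma word_bits_subst a w j k : word_bits (subst a w) j k =
  nth false (odflt a (nth (Some [::]) w j)) k.
Proof.
rewrite /word_bits /subst; have [jw|wj] := ltnP j (size w).
  by rewrite (nth_map (Some [::])).
by rewrite !nth_default ?size_map.
Qed.

Lemma word_bits_blocks_prefix v a m n j k :
  m <= n -> j < size (blocks v a m) ->
  word_bits (blocks v a n) j k = word_bits (blocks v a m) j k.
Proof.
move=> /subnK <- jm; elim: (n - m) => [//|d IH] /=.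
rewrite word_bits_cat ifT //; apply: leq_trans jm _.
rewrite !size_blocks -!(big_mkord xpredT (fun i => size (v i))).
by rewrite (@big_cat_nat _ _ _ m 0 (d + m)) //= ?leq_addr ?leq_addl.
Qed.

(* Only coordinates k <= i receive the bit b i k, the others get the default
   value false: the i-th letter thus ranges over a finite set, and coordinate k
   is free from block k on. *)
Definition letters (b : nat -> nat -> bool) (i : nat) : seq bool :=
  mkseq (b i) i.+1.

Lemma nth_letters b i k : nth false (letters b i) k = (k <= i) && b i k.
Proof.
have [ki|ik] := leqP k i; first by rewrite nth_mkseq.
by rewrite nth_default // size_mkseq.
Qed.

(** Coordinate k of a concatenation sees only the bits offered to k. This is what makes the set of
    limit points a product. *)
Lemma word_bits_blocks_ext v b b' n j k : (forall i, i < n -> b i k = b' i k) ->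
  word_bits (blocks v (letters b) n) j k =
  word_bits (blocks v (letters b') n) j k.
Proof.
elim: n j => [//|n IHn] j bb' /=; rewrite !word_bits_cat !size_blocks.
case: ifP => _; first by apply: IHn => i ni; apply: bb'; exact: ltnW.
rewrite !word_bits_subst; case: (nth (Some [::]) _ _) => // /=.
by rewrite !nth_letters bb'.
Qed.

Lemma leq_size_blocks A (v : nat -> seq (option A)) a n :
  (forall i, variable_word (v i)) -> n <= size (blocks v a n).
Proof.
move=> Vv; elim: n => //= n IHn; rewrite size_cat size_map -addn1 leq_add //.
by case: (v n) (Vv n).
Qed.

(** * Convergence of colourings along substituted words *)

Local Open Scope ring_scope.

Lemma ultra_lim (R : realType) T (p : set_system T) (c : T -> R) :
  UltraFilter p -> (forall w, 0 <= c w <= 1) ->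
  exists l : R, 0 <= l <= 1 /\ forall e, 0 < e -> p [set w | `|l - c w| < e].
Proof.
move=> Up c01.
have Uc : UltraFilter (fmap c p) by exact: fmap_ultra.
have := @segment_compact R 0 1; rewrite compact_ultra => /(_ _ Uc)[|l [l01 cl]].
  suff : p (c @^-1` `[0, 1]) by [].
  by apply: filterE => w; rewrite /= in_itv /= c01.
exists l; split; first by move: l01; rewrite /= in_itv.
by move=> e e0; move/cvgrPdist_lt : cl => /(_ _ e0).
Qed.

Lemma convergent_substitutions (R : realType) (A : eqType) (L : nat -> seq A)
    (c : seq A -> R) : (forall w, 0 <= c w <= 1) ->
  exists v : nat -> seq (option A), (forall i, variable_word (v i)) /\
    forall a : nat -> A, (forall i, a i \in L i) ->
      cvgn (fun i => c (blocks v a i.+1)).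
Proof.
move=> c01; have [p [q [Up Uq pp qV qp]]] := substitution_ultrafilters A.
have /choice[h] : forall u, exists l : R, 0 <= l <= 1 /\
    forall e, 0 < e -> p [set w | `|l - c (u ++ w)| < e].
  by move=> u; apply: ultra_lim.
move=> /all_and2[h01 hc].
have hh u e : 0 < e -> p [set w | `|h u - h (u ++ w)| < e].
  move=> e0; have e20 : 0 < e / 2 by rewrite divr_gt0.
  (* By idempotence, for p-most w and then p-most z, c(uwz) is close to h(u); it is also close to
     h(uw). *)
  have ph : conv p p [set w | `|h u - c (u ++ w)| < e / 2].
    by rewrite pp; exact: hc.
  have {}ph : p [set w | p [set z | `|h u - c (u ++ (w ++ z))| < e / 2]] by [].
  apply: filterS ph => w /= pz.
  have [z [/= z1 z2]] := filter_ex (filterI pz (hc (u ++ w) _ e20)).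
  rewrite -catA in z2.
  rewrite (splitr e) (le_lt_trans (ler_distD (c (u ++ (w ++ z))) _ _)) //.
  by rewrite ltrD // distrC.
pose good i u w :=
  `|h u - c (u ++ w)| < 2^-1 ^+ i /\ `|h u - h (u ++ w)| < 2^-1 ^+ i.
have e0 i : 0 < 2^-1 ^+ i :> R by rewrite exprn_gt0 // invr_gt0.
have /choice[step stepP] : forall x : nat * seq (seq A), exists v,
    variable_word v /\ forall u, u \in x.2 -> forall a, a \in L x.1 ->
      good x.1 u (subst a v).
  move=> [i s] /=.
  (* Finitely many conditions, each holding q-almost surely because every substitution maps q to
     p. *)
  have qgood : q [set v | forall u, u \in s -> forall a, a \in L i ->
      good i u (subst a v)].
    apply: filter_all_seq => u _; apply: filter_all_seq => a _.
    have pg : p [set w | good i u w].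
      by apply: filterS (filterI (hc u _ (e0 i)) (hh u _ (e0 i))) => w [].
    by rewrite -(qp a) in pg.
  by have [v [Vv gv]] := filter_ex (filterI qV qgood); exists v.
(* All concatenations of n substituted blocks with letters from the lists: v_n must be good for each
   of them at once. *)
pose fix pre n : seq (seq A) := if n is m.+1 then
  [seq u ++ subst a (step (m, pre m)) | u <- pre m, a <- L m] else [:: [::]].
pose v n := step (n, pre n).
exists v; split=> [i|a aL]; first by have [] := stepP (i, pre i).
have bpre n : blocks v a n \in pre n.
  elim: n => [|n IHn]; first by rewrite inE.
  by apply/allpairsP; exists (blocks v a n, a n); split=> //; exact: aL.
have gb n : good n (blocks v a n) (subst (a n) (v n)).
  by have [_] := stepP (n, pre n); apply=> //; exact: aL.
pose H n := h (blocks v a n).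
have Hcvg : cvgn H.
  have e2 : (fun n => 2 * 2^-1 ^+ n) @ \oo --> (0 : R).
    rewrite -(mulr0 2); apply: cvgMr; apply: cvg_expr.
    by rewrite ger0_norm ?invr_ge0 // invf_lt1 // ltr1n.
  (* Since H moves by less than 2^-n at step n, adding the tail 2 * 2^-n of the geometric series
     makes it nonincreasing, and it is bounded below by 0. *)
  suff : cvgn (fun n => H n + 2 * 2^-1 ^+ n).
    move=> He; have -> : H = (fun n => (H n + 2 * 2^-1 ^+ n) - 2 * 2^-1 ^+ n).
      by apply/funext => n; rewrite addrK.
    exact: is_cvgB He (cvgP _ e2).
  apply: nonincreasing_is_cvgn.
    apply/nonincreasing_seqP => n; have [_] := gb n.
    rewrite -/(blocks v a n.+1) -/(H n) -/(H n.+1) exprS.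
    move: (2^-1 ^+ n) (e0 n) => e _; rewrite ltr_norml => /andP[H1 H2].
    lra.
  exists 0 => _ [n _ <-]; apply: addr_ge0.
    by have /andP[] := h01 (blocks v a n).
  by apply: mulr_ge0 => //; exact: ltW.
have e1 : (fun n => 2^-1 ^+ n) @ \oo --> (0 : R).
  apply: cvg_expr.
  by rewrite ger0_norm ?invr_ge0 // invf_lt1 // ltr1n.
apply/cvg_ex; exists (lim (H @ \oo)).
have d0 : (fun n => H n - c (blocks v a n.+1)) @ \oo --> (0 : R).
  apply/cvgr0Pnorm_lt => e epos; have /cvgr0Pnorm_lt/(_ _ epos) := e1.
  apply: filterS => n; rewrite ger0_norm ?(ltW (e0 _)) // => en.
  by have [hc_lt _] := gb n; exact: lt_trans hc_lt en.
have -> : (fun i => c (blocks v a i.+1)) =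
    (fun n => H n - (H n - c (blocks v a n.+1))).
  by apply/funext => n; rewrite opprB addrC subrK.
by rewrite -[X in _ --> X]subr0; exact: cvgB Hcvg d0.
Qed.

(** * From Baire functions to colourings *)

(** If t exceeds s by more than 1/(n+1), the least i with s <= i/(n+1) gives a threshold separating
    them, and i <= n because t <= 1. *)
Lemma threshold_dist (R : realType) (n : nat) (s t : R) :
  0 <= s <= 1 -> 0 <= t <= 1 ->
  (forall i, (i <= n)%N -> (i%:R / n.+1%:R < s) = (i%:R / n.+1%:R < t)) ->
  `|s - t| <= n.+1%:R^-1.
Proof.
wlog st : s t / s <= t => [H s01 t01 E|s01 t01 E].
  have [st|/ltW ts] := leP s t; first exact: H.
  by rewrite distrC; apply: H => // i im; rewrite E.
have n0 : 0 < n.+1%:R :> R by rewrite ltr0n.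
rewrite distrC ger0_norm ?subr_ge0 // leNgt; apply/negP => ts.
have ex : exists i : nat, s * n.+1%:R <= i%:R.
  by exists n.+1; apply: ler_piMl; [exact: ltW|case/andP: s01].
case: (ex_minnP ex) => i si imin.
have it : i%:R / n.+1%:R < t.
  case: i si imin => [_ _|i _ imin].
    rewrite mul0r; case/andP: s01 => s0 _.
    by rewrite (le_lt_trans s0) // -subr_gt0 (lt_trans _ ts) // invr_gt0.
  have : (i%:R / n.+1%:R < s).
    by rewrite ltr_pdivrMr // ltNge; apply/negP => /imin; rewrite ltnn.
  rewrite -[i.+1%:R]natr1 mulrDl div1r; move: ts.
  move: (i%:R / n.+1%:R : R) => a; move: (n.+1%:R^-1 : R) => e; lra.
have iN : (i <= n)%N.
  rewrite -ltnS -(ltr_nat R) -[ltRHS]mul1r -ltr_pdivrMr // (lt_le_trans it) //.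
  by case/andP: t01.
by have := E _ iN; rewrite it ltr_pdivrMr // ltNge si.
Qed.

Lemma baire_cantor_fusion (R : realType)
    (f : nat -> cantor_omega -> unit_interval R) :
  (forall n, baire_fun (f n)) ->
  exists E : nat -> (nat -> bool) -> nat -> bool,
    [/\ forall k i, exists n, forall b b',
          (forall j, (j < n)%N -> b j = b' j) -> E k b i = E k b' i,
        forall k n b b', (k <= n)%N -> b n != b' n -> E k b <> E k b' &
        forall n z z', (forall j k, (j < n)%N -> z j k = z' j k) ->
          `|set_val (f n (apply_tree E z)) - set_val (f n (apply_tree E z'))|
            <= n.+1%:R^-1].
Proof.
move=> hf.
pose U n i : set (unit_interval R) := [set y | i%:R / n.+1%:R < set_val y].
have oU n i : open (U n i).
  exists [set y : R | i%:R / n.+1%:R < y] => //; exact: open_gt.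
have /choice[G GP] : forall x : nat * nat,
    exists g : set cantor_omega * (nat -> set cantor_omega),
    [/\ open g.1, forall j, nowhere_dense (g.2 j) &
      f x.1 @^-1` U x.1 x.2 = g.1 `+` \bigcup_j g.2 j].
  move=> [n i]; have [V [_ [oV [F Fnd ->] fE]]] := hf n _ (oU n i).
  by exists (V, F).
pose D (x : nat * nat * nat) : set (nat -> nat -> bool) :=
  ~` closure ((G x.1).2 x.2).
(* Stage n treats the thresholds of f_n and the complements [D x] with code below n, so that each
   [D x] is met at stage [(pickle x).+1]. *)
pose L n : seq (set (nat -> nat -> bool)) :=
  [seq (G (n, i)).1 | i <- iota 0 n.+1] ++
  [seq D x | x <- pmap unpickle (iota 0 n)].
have [n O|E [E1 E2 E3]] := @fusion L.
  rewrite mem_cat => /orP[] /mapP[x _ ->]; apply: open_cyl_open.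
    by have [] := GP (n, x).
  by rewrite openC; exact: closed_closure.
exists E; split=> // n z z' zz'.
(* A cylinder deciding the dense set [D x] cannot be disjoint from it, hence lies inside it. *)
have avoid y x : D x (apply_tree E y).
  have xL : D x \in L (pickle x).+1.
    rewrite mem_cat; apply/orP; right; apply: map_f; rewrite mem_pmap.
    by apply/mapP; exists (pickle x); rewrite ?pickleK // mem_iota ltnS /=.
  have [e [u [Du uy]]] := E3 _ y _ xL.
  have ndx : nowhere_dense ((G x.1).2 x.2) by have [] := GP x.1.
  have [w uw Dw] := cyl_meets_dense e u ndx.
  case: Du => [Du|Du]; first exact/Du/uy.
  by have : (cyl e u `&` D x) w by []; rewrite Du.
have UG i y : U n i (f n (apply_tree E y)) <-> (G (n, i)).1 (apply_tree E y).
  have [_ _ fE] := GP (n, i).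
  have nF : ~ (\bigcup_j (G (n, i)).2 j) (apply_tree E y).
    by move=> [j _ Fj]; apply: (avoid y (n, i, j)); exact: subset_closure.
  have -> : U n i (f n (apply_tree E y)) =
    ((G (n, i)).1 `+` \bigcup_j (G (n, i)).2 j) (apply_tree E y) by rewrite -fE.
  split=> [[[]|[]]//|GE]; by left.
have f01 y : 0 <= set_val (f n y) <= 1.
  by have := set_valP (f n y); rewrite /= in_itv.
apply: threshold_dist => // i im.
have iL : (G (n, i)).1 \in L n.
  rewrite mem_cat; apply/orP; left.
  by apply/mapP; exists i; rewrite // mem_iota.
have [e [u [Du uz]]] := E3 _ z _ iL.
have zu := uz z (fun _ _ _ => erefl).
have z'u := uz z' zz'.
(* Both points lie in one cylinder that decides this open set. *)
have zz : (G (n, i)).1 (apply_tree E z) <-> (G (n, i)).1 (apply_tree E z').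
  case: Du => [Du|Du]; first by split=> _; exact: Du.
  have nG y : cyl e u y -> ~ (G (n, i)).1 y.
    by move=> uy Gy; have : (cyl e u `&` (G (n, i)).1) y by []; rewrite Du.
  by split=> [/(nG _ zu)|/(nG _ z'u)].
have {}zz : U n i (f n (apply_tree E z)) <-> U n i (f n (apply_tree E z')).
  by rewrite !UG.
by apply/idP/idP => /zz.
Qed.

(** * The perfect sets and the subsequence *)

Lemma variable_word_index A (w : seq (option A)) :
  variable_word w -> exists2 p, (p < size w)%N & forall c, nth c w p = None.
Proof.
rewrite /variable_word /= -has_predC => hw.
exists (find (predC isSome) w) => [|c]; first by rewrite -has_find.
by have := nth_find c hw; case: (nth _ _ _).
Qed.

Theorem theorem10 (R : realType) (f : nat -> cantor_omega -> unit_interval R)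
    (hf : forall n, baire_fun (f n)) :
  exists (N : set nat) (nu : nat -> nat) (P : nat -> set cantor_space),
    [/\ infinite_set N,
        increasing_seq nu /\ range nu = N,
        forall k, compact_perfect (P k) /\ P k !=set0 &
        forall x : cantor_omega, box P x ->
          exists l : unit_interval R, (fun i => f (nu i) x) @ \oo --> l].
Proof.
have [E [Econt Einj Edist]] := baire_cantor_fusion hf.
(* The length of the word selects the function. For a concatenation it depends only on the blocks,
   not on the letters substituted, so it can index the subsequence. *)
pose c (w : seq (seq bool)) : R :=
  set_val (f (size w) (apply_tree E (word_bits w))).
have f01 n y : 0 <= set_val (f n y) <= 1.
  by have := set_valP (f n y); rewrite /= in_itv.
pose L i : seq (seq bool) := [seq val t | t <- enum {: i.+1.-tuple bool}].
have lettersL b i : letters b i \in L i.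
  have sz : size (letters b i) == i.+1 by rewrite size_mkseq.
  by apply/mapP; exists (Tuple sz); rewrite // mem_enum.
have [|v [Vv vcvg]] := @convergent_substitutions R (seq bool) L c.
  by move=> w; exact: f01.
pose nu i := (\sum_(j < i.+1) size (v j))%N.
have sizeE b i : size (blocks v (letters b) i.+1) = nu i by rewrite size_blocks.
have nu_lt i : (i < nu i)%N.
  by rewrite -(sizeE (fun _ _ => false)); exact: leq_size_blocks.
have nu_incr : increasing_seq nu.
  apply/increasing_seqP => i; rewrite ltEnat /= /nu [ltnRHS]big_ord_recr /=.
  rewrite -[ltnLHS]addn0 ltn_add2l.
  by have [p + _] := variable_word_index (Vv i.+1); exact: leq_ltn_trans.
(* The infinite concatenation: blocks are nonempty, so letter j already occurs in the first j+1 of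
   them. *)
pose W (b : nat -> nat -> bool) j k :=
  word_bits (blocks v (letters b) j.+1) j k.
have WE b n j k : (j < size (blocks v (letters b) n))%N ->
    W b j k = word_bits (blocks v (letters b) n) j k.
  move=> jn; have jj := leq_size_blocks (letters b) j.+1 Vv.
  have [jn'|/ltnW nj] := leqP j.+1 n.
    by rewrite (word_bits_blocks_prefix _ jn').
  by rewrite /W (word_bits_blocks_prefix _ nj).
(* The same bits are offered to every coordinate, but only those offered to k matter. *)
pose g k (beta : nat -> bool) := E k ((W (fun i _ => beta i)) ^~ k).
exists (range nu), nu, (fun k => range (g k : cantor_space -> cantor_space)).
split=> // [|k|x Px].
- move=> /(finite_preimage (f := nu) (B := range nu)) nuN; apply: infinite_nat.
  apply: sub_finite_set (nuN _) => [i _|i j _ _ ij]; first by exists i.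
  exact: inc_inj nu_incr _ _ ij.
- apply: compact_perfect_range => [i|b n].
    have [n En] := Econt k i; exists n => b b' bb'; apply: En => j jn.
    by apply: word_bits_blocks_ext => m mj; apply: bb'; exact: leq_trans mj _.
  (* Since m >= n, the first n bits are kept; since m >= k, the m-th letter offers its bit to
     coordinate k. The flip shows at the variable of block m, at a position at least m, hence at
     least k, as [Einj] requires. *)
  pose m := maxn n k; pose b' i := if i == m then ~~ b m else b i.
  exists b' => [j jn|].
    by rewrite /b' ltn_eqF // (leq_trans jn) ?leq_maxl.
  have [p pm pN] := variable_word_index (Vv m).
  have Wm (d : nat -> bool) :
      W (fun i _ => d i) (\sum_(j < m) size (v j) + p)%N k = d m.
    rewrite (WE _ m.+1) /= ?word_bits_cat ?size_cat size_blocks ?size_map.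
      rewrite ltnNge leq_addr /= addKn word_bits_subst pN /= nth_letters.
      by rewrite leq_maxr.
    by rewrite ltn_add2l.
  apply/eqP; rewrite eq_sym; apply/eqP.
  apply: (Einj k (\sum_(j < m) size (v j) + p)%N).
    have := leq_size_blocks (fun _ => [::]) m Vv; rewrite size_blocks => msz.
    by rewrite (leq_trans (leq_maxr n k)) // (leq_trans msz) ?leq_addr.
  by rewrite !Wm /b' eqxx; case: (b m).
have /choice[beta betaP] : forall k, exists beta, g k beta = x k.
  by move=> k; have [beta _ <-] := Px k; exists beta.
pose b i k := beta k i.
have xE : x = apply_tree E (W b).
  apply/funext => k; rewrite -betaP /g /apply_tree; congr (E k _).
  by apply/funext => j; exact: word_bits_blocks_ext.
have := vcvg (letters b) (lettersL b) => /cvg_ex[l cl].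
have fl : (fun i => set_val (f (nu i) x) : R) @ \oo --> l.
  (* The sequence of x and the padded concatenation share their first [nu i] letters, so the values
     differ by at most 1/(nu i + 1), which is below 1/(i+1). *)
  have d0 : (fun i => set_val (f (nu i) x) - c (blocks v (letters b) i.+1))
      @ \oo --> (0 : R).
    apply/cvgr0Pnorm_lt => e e0.
    have := @cvg_harmonic R; move=> /cvgr0Pnorm_lt/(_ _ e0).
    apply: filterS => i; rewrite ger0_norm ?invr_ge0 //; apply: le_lt_trans.
    rewrite /c sizeE xE; apply: le_trans (Edist _ _ _ _) _ => [j k ji|].
      by apply: WE; rewrite sizeE.
    by rewrite lef_pV2 ?posrE ?ltr0n // ler_nat ltnS ltnW.
  have -> : (fun i => set_val (f (nu i) x) : R) = (fun i =>
      c (blocks v (letters b) i.+1) +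
      (set_val (f (nu i) x) - c (blocks v (letters b) i.+1))).
    by apply/funext => i; rewrite addrC subrK.
  by rewrite -[l]addr0; exact: cvgD.
have l01 : l \in (`[0, 1]%classic : set R).
  apply/mem_set; rewrite /= in_itv /=; apply/andP; split.
    apply: (@closed_cvg _ _ _ _ _ (fun y : R => 0 <= y) (@closed_ge _ 0) _ _ fl).
    by apply: nearW => i; have /andP[] := f01 (nu i) x.
  apply: (@closed_cvg _ _ _ _ _ (fun y : R => y <= 1) (@closed_le _ 1) _ _ fl).
  by apply: nearW => i; have /andP[] := f01 (nu i) x.
exists (exist _ l l01); apply: cvg_set_type.
exact: fl.
Qed.
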